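(* For every non-negative integer $t$, the graph $P(17)\vee K_t$ satisfies $\chi(H)\leq\binom{\omega(H)+1}{2}$ for every induced subgraph $H$ of $P(17)\vee K_t$, but $P(17)\vee K_t$ is not perfectly divisible.
   Context: All graphs are finite and simple; $\chi$ denotes chromatic number and $\omega$ denotes clique number. The Paley graph $P(17)$ has vertex set $\mathbb F_{17}$, where two distinct vertices $x,y$ are adjacent if and only if $x-y$ is a nonzero square in $\mathbb F_{17}$. For vertex-disjoint graphs $G$ and $F$, the join $G\vee F$ is obtained from their disjoint union by adding all edges between $V(G)$ and $V(F)$; $K_t$ is the complete graph on $t$ vertices, and $K_0$ is the empty graph. A graph is perfect if every induced subgraph $H$ of it satisfies $\chi(H)=\omega(H)$. A graph $G$ is perfectly divisible if, for every induced subgraph $H$ of $G$ with at least one edge, $V(H)$ can be partitioned into sets $A$ and $B$ (possibly empty) such that $H[A]$ is perfect and $\omega(H[B])<\omega(H)$. *)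

(* Defs.v *)
From mathcomp Require Import all_boot all_order all_algebra.
Set Implicit Arguments.
Unset Strict Implicit.
Unset Printing Implicit Defensive.

Record sgraph := SGraph {
  vertex :> finType;
  adj : rel vertex;
  adj_sym : symmetric adj;
  adj_irr : irreflexive adj
}.

Definition has_edge (G : sgraph) : Prop := exists x y : G, adj x y.

Section Induced.
Variables (G : sgraph) (S : {set G}).

Definition induced_adj : rel {x : G | x \in S} := fun x y => adj (val x) (val y).

Lemma induced_sym : symmetric induced_adj.
Proof. by move=> x y; apply: adj_sym. Qed.

Lemma induced_irr : irreflexive induced_adj.
Proof. by move=> x; apply: adj_irr. Qed.

Definition induced : sgraph := SGraph induced_sym induced_irr.
End Induced.

Definition clique (G : sgraph) (K : {set G}) : bool :=
  [forall x in K, forall y in K, (x != y) ==> adj x y].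

Definition omega (G : sgraph) : nat := \max_(K : {set G} | clique K) #|K|.

Definition colorable (G : sgraph) (k : nat) : bool :=
  [exists c : {ffun G -> 'I_k}, forall x, forall y, adj x y ==> (c x != c y)].

Lemma ex_colorable (G : sgraph) : exists k, colorable G k.
Proof.
exists #|G|; apply/existsP; exists [ffun x => enum_rank x].
apply/forallP=> x; apply/forallP=> y; apply/implyP=> xy.
rewrite !ffunE (inj_eq enum_rank_inj).
by apply/eqP=> exy; rewrite exy adj_irr in xy.
Qed.

(* The least number of colours of a proper colouring; 0 when G has no vertex. *)
Definition chi (G : sgraph) : nat := ex_minn (ex_colorable G).

Definition perfect (G : sgraph) : Prop :=
  forall S : {set G}, chi (induced S) = omega (induced S).

(* A and B are sets of vertices of H = induced S, so induced A and induced B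
   are induced subgraphs of H. *)
Definition perfectly_divisible (G : sgraph) : Prop :=
  forall S : {set G}, has_edge (induced S) ->
    exists A B : {set induced S},
      [/\ A :|: B = setT, A :&: B = set0, perfect (induced A)
        & omega (induced B) < omega (induced S)].

Section Complete.
Variable t : nat.

Definition complete_adj : rel 'I_t := fun x y => x != y.

Lemma complete_sym : symmetric complete_adj.
Proof. by move=> x y; rewrite /complete_adj eq_sym. Qed.

Lemma complete_irr : irreflexive complete_adj.
Proof. by move=> x; rewrite /complete_adj eqxx. Qed.

Definition complete : sgraph := SGraph complete_sym complete_irr.
End Complete.

Section Join.
Variables G F : sgraph.

Definition join_adj : rel (G + F)%type := fun u v =>
  match u, v with
  | inl x, inl y => adj x y
  | inr x, inr y => adj x y
  | _, _ => true
  end.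

Lemma join_sym : symmetric join_adj.
Proof. by move=> [x|x] [y|y] //=; apply: adj_sym. Qed.

Lemma join_irr : irreflexive join_adj.
Proof. by move=> [x|x] /=; apply: adj_irr. Qed.

Definition join : sgraph := SGraph join_sym join_irr.
End Join.

Section Paley17.
Import GRing.Theory.
Local Open Scope ring_scope.

Definition nonzero_square (a : 'F_17) : bool :=
  (a != 0) && [exists z : 'F_17, a == z ^+ 2].

Definition paley17_adj : rel 'F_17 := fun x y =>
  (x != y) && nonzero_square (x - y).

(* -1 = 4 ^ 2 in F_17. *)
Lemma nonzero_squareN (a : 'F_17) : nonzero_square a -> nonzero_square (- a).
Proof.
case/andP=> a0 /existsP[z /eqP az]; apply/andP; split; first by rewrite oppr_eq0.
apply/existsP; exists (4%:R * z); rewrite exprMn -az.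
have -> : (4%:R ^+ 2 : 'F_17) = -1 by apply/eqP.
by rewrite mulN1r.
Qed.

Lemma paley17_sym : symmetric paley17_adj.
Proof.
move=> x y; rewrite /paley17_adj eq_sym; congr (_ && _).
by apply/idP/idP=> /nonzero_squareN; rewrite opprB.
Qed.

Lemma paley17_irr : irreflexive paley17_adj.
Proof. by move=> x; rewrite /paley17_adj eqxx. Qed.

Definition paley17 : sgraph := SGraph paley17_sym paley17_irr.
End Paley17.

(* Main.v *)
Require Import Defs.
From mathcomp Require Import all_boot all_order all_algebra.
Set Implicit Arguments.
Unset Strict Implicit.
Unset Printing Implicit Defensive.

(** Call a map that preserves adjacency a homomorphism. Then chi G <= k means
    that G maps to complete k (chi_leP) and k <= omega G that complete k maps
    to G (omega_geP), so both invariants are monotone under homomorphisms.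

    The bound on chi passes from G to its join with a complete graph
    (join_complete_bound): adding s dominating vertices raises chi and omega by
    s, and 'C(w + 1, 2) grows by at least one when w does. For the Paley graph
    itself (chi_paley17_bound), chi <= 6 = 'C(4, 2) settles the subgraphs that
    contain a triangle, those without edges are trivial, and the remaining
    case is that a triangle-free induced subgraph is 3-colourable
    (chi_triangle_free_paley17).

    Perfect divisibility already fails for the induced subgraph paley17. As its
    clique number is 3, the part B would be triangle-free. But every
    triangle-free set of vertices of paley17 is disjoint from some induced
    5-cycle (triangle_free_misses_cycle5); that cycle lies in A, and it is not
    perfect.

    Both facts on triangle-free sets are inherited by subsets, and are checked
    by one branching search over the triangle-free sets (exhaust, exhaustP),
    which stops as soon as the vertices that can still be chosen all fit in one
    set with the desired property. *)

(** * Homomorphisms, chromatic number and clique number *)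

Definition hom (G H : sgraph) : Prop :=
  exists f : G -> H, forall x y, adj x y -> adj (f x) (f y).

Lemma hom_trans (G H K : sgraph) : hom G H -> hom H K -> hom G K.
Proof.
by move=> [f fP] [g gP]; exists (g \o f) => x y /fP/gP.
Qed.

Lemma hom_induced (G : sgraph) (S : {set G}) : hom (induced S) G.
Proof. by exists val. Qed.

Lemma hom_complete (m n : nat) : m <= n -> hom (complete m) (complete n).
Proof.
move=> le_mn; exists (widen_ord le_mn) => i j.
by apply: contra => /eqP[] /ord_inj ->.
Qed.

Lemma chi_leP (G : sgraph) (k : nat) : chi G <= k <-> hom G (complete k).
Proof.
have colP n : colorable G n <-> hom G (complete n).
  split=> [/existsP[c /forallP cP]|[c cP]].
    by exists c => x y xy; move/forallP/(_ y)/implyP/(_ xy): (cP x).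
  apply/existsP; exists [ffun x => c x]; apply/forallP => x; apply/forallP => y.
  by apply/implyP => /cP; rewrite !ffunE.
rewrite /chi; case: ex_minnP => m /colP homm minm; split=> [le_mk|/colP/minm //].
exact: hom_trans homm (hom_complete le_mk).
Qed.

Lemma omega_geP (G : sgraph) (k : nat) : k <= omega G <-> hom (complete k) G.
Proof.
split=> [|[f fP]].
  have c0 : clique (set0 : {set G}).
    by apply/forallP => x; apply/implyP; rewrite inE.
  have /(eq_bigmax_cond (fun K : {set G} => #|K|)) [K cK omK] :
      0 < #|[pred K : {set G} | clique K]|.
    by apply/card_gt0P; exists set0.
  rewrite /omega omK => le_k.
  exists (fun i : complete k => enum_val (widen_ord le_k i)) => i j ij.
  have /forallP/(_ (enum_val (widen_ord le_k i)))/implyP/(_ (enum_valP _)) := cK.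
  move/forallP/(_ (enum_val (widen_ord le_k j)))/implyP/(_ (enum_valP _)).
  move/implyP; apply; rewrite (inj_eq enum_val_inj).
  by apply: contra ij => /eqP[] /ord_inj ->.
have f_inj : injective f.
  move=> i j fij; apply/eqP; apply: contraT => /(fP i j).
  by rewrite fij adj_irr.
have cK : clique (f @: [set: complete k]).
  apply/forallP => x; apply/implyP => /imsetP[i _ ->].
  apply/forallP => y; apply/implyP => /imsetP[j _ ->].
  by rewrite (inj_eq f_inj); apply/implyP => /fP.
have := @leq_bigmax_cond _ _ (fun K : {set G} => #|K|) _ cK.
by rewrite card_imset // cardsT card_ord.
Qed.

Lemma leq_chi (G H : sgraph) : hom G H -> chi G <= chi H.
Proof. by move=> GH; apply/chi_leP/(hom_trans GH)/chi_leP. Qed.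

Lemma leq_omega (G H : sgraph) : hom G H -> omega G <= omega H.
Proof. by move=> GH; apply/omega_geP/(hom_trans _ GH)/omega_geP. Qed.

(** Being perfect forces chi = omega on every graph that embeds as an induced
    subgraph: such a graph and its image map to each other. *)
Lemma perfect_embedding (G H : sgraph) (f : H -> G) :
  (forall x y, adj (f x) (f y) = adj x y) -> perfect G -> chi H = omega H.
Proof.
move=> fE /(_ (f @: setT)) perf.
have to : hom H (induced (f @: setT)).
  by exists (fun x => exist _ (f x) (imset_f f (in_setT x))) => x y; rewrite -fE.
have from : hom (induced (f @: setT)) H.
  have inv (u : induced (f @: setT)) : exists x, f x == val u.
    by case/imsetP: (valP u) => x _ ->; exists x.
  exists (fun u => xchoose (inv u)) => u v uv.
  by rewrite -fE (eqP (xchooseP (inv u))) (eqP (xchooseP (inv v))).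
apply/eqP; rewrite eqn_leq (leq_trans (leq_chi to)) ?perf ?leq_omega //=.
by rewrite (leq_trans (leq_omega to)) // -perf leq_chi.
Qed.

Lemma omega_triangle (G : sgraph) (x y z : G) :
  adj x y -> adj y z -> adj x z -> 3 <= omega G.
Proof.
move=> xy yz xz; apply/omega_geP.
exists (fun i : complete 3 => nth x [:: x; y; z] i).
by move=> [[|[|[|//]]] ?] [[|[|[|//]]] ?] //= _; rewrite // adj_sym.
Qed.

Lemma chi_le_omega1 (G : sgraph) : omega G <= 1 -> chi G <= omega G.
Proof.
move=> om1; apply/chi_leP.
have edgeless (x y : G) : adj x y = false.
  apply/negP => xy; suff : 2 <= omega G by rewrite leqNgt ltnS om1.
  apply/omega_geP; exists (fun i : complete 2 => if val i == 0 then x else y).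
  by move=> [[|[|//]] ?] [[|[|//]] ?] //= _; rewrite // adj_sym.
have [x _|G0] := pickP (@predT G); last first.
  by exists (fun x => False_rect _ (notF (esym (G0 x)))) => x; have := G0 x.
have : 0 < omega G.
  by apply/omega_geP; exists (fun=> x) => i j; rewrite !ord1 adj_irr.
case: (omega G) => // n _; exists (fun=> ord0) => y z.
by rewrite edgeless.
Qed.

(** * Joins with complete graphs *)

Lemma leq_addn_bin2 (n s : nat) : 'C(n.+1, 2) + s <= 'C((n + s).+1, 2).
Proof.
elim: s => [|s IHs]; first by rewrite !addn0.
by rewrite !addnS (leq_ltn_trans IHs) // (binS _.+1 1) bin1 -addn1 leq_add2l.
Qed.

(** A set of vertices of the join is a set S0 of vertices of G together with
    s := #|S1| dominating vertices. Colour S0 and S1 with disjoint palettes,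
    and add S1 to a maximum clique of S0. *)
Lemma join_complete_bound (G : sgraph) (t : nat) :
  (forall S : {set G}, chi (induced S) <= 'C(omega (induced S) + 1, 2)) ->
  forall S : {set join G (complete t)},
    chi (induced S) <= 'C(omega (induced S) + 1, 2).
Proof.
move=> bound S.
pose S0 : {set G} := [set x | inl x \in S].
pose S1 : {set complete t} := [set i | inr i \in S].
have inS0 x : inl x \in S -> x \in S0 by rewrite inE.
have inS1 i : inr i \in S -> i \in S1 by rewrite inE.
have S0in x : x \in S0 -> inl x \in S by rewrite inE.
have S1in i : i \in S1 -> inr i \in S by rewrite inE.
have chiS : chi (induced S) <= chi (induced S0) + #|S1|.
  apply/chi_leP; have /chi_leP [c cP] := leqnn (chi (induced S0)).
  pose col v : v \in S -> 'I_(chi (induced S0) + #|S1|) :=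
    match v with
    | inl x => fun vS => lshift #|S1| (c (exist _ x (inS0 x vS)))
    | inr i => fun vS => rshift _ (enum_rank_in (inS1 i vS) i)
    end.
  exists (fun u : induced S => col (val u) (valP u) : complete _).
  move=> [[x|i] uS] [[y|j] vS] //= uv; rewrite /= /complete_adj.
  - by rewrite eq_lshift; apply: cP.
  - by rewrite eq_lrshift.
  - by rewrite eq_rlshift.
  rewrite eq_rshift; apply: contra uv => /eqP eq_ij; apply/eqP.
  by move/(congr1 enum_val): eq_ij; rewrite !enum_rankK_in ?inS1.
have omS : omega (induced S0) + #|S1| <= omega (induced S).
  apply/omega_geP; have /omega_geP [q qP] := leqnn (omega (induced S0)).
  exists (fun i : complete (_ + _) => match split i with
    | inl j => exist _ (inl (val (q j))) (S0in _ (valP (q j))) : induced S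
    | inr j => exist _ (inr (enum_val j)) (S1in _ (enum_valP j))
    end).
  move=> i j; rewrite /adj /= /complete_adj -(inj_eq (can_inj splitK)).
  case: (split i) (split j) => [k|k] [l|l] //=; rewrite /induced_adj /=.
    exact: qP.
  by rewrite /complete_adj (inj_eq enum_val_inj).
apply: leq_trans chiS _; apply: leq_trans (leq_add (bound S0) (leqnn _)) _.
rewrite !addn1; apply: leq_trans (leq_addn_bin2 _ _) _.
exact: leq_bin2l.
Qed.

(** * Exhaustive search over triangle-free sets *)

Section Search.
Variables (T : eqType) (e : rel T).

Definition triangle_free (B : pred T) : Prop :=
  forall x y z, B x -> B y -> B z -> ~~ [&& e x y, e y z & e x z].

(** The conditional, instead of a boolean connective, keeps a call-by-value
    evaluation from running the inner test on every x; likewise below. *)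
Definition compatible (cur : seq T) (y : T) : bool :=
  all (fun x => if e x y then ~~ has (fun z => e x z && e y z) cur else true) cur.

(** Decides the vertices of cand one after the other, cur being those put in the
    triangle-free set so far. A triangle-free set still reachable in the branch
    consists of cur and of vertices of cand that close no triangle with two
    vertices of cur; the branch ends once good holds of cur and all those
    vertices together. *)
Fixpoint exhaust (good : pred (seq T)) (cur cand : seq T) : bool :=
  if good (cur ++ filter (compatible cur) cand) then true
  else if cand is x :: cand' then
    if exhaust good cur cand' then
      if compatible cur x then exhaust good (x :: cur) cand' else true
    else false
  else false.

Lemma triangle_free_compatible cur (B : pred T) y :
  triangle_free B -> all B cur -> B y -> compatible cur y.
Proof.
move=> Btf /allP curB By; apply/allP => x /curB Bx; case: ifP => // xy.
apply/hasPn => z /curB Bz; have := Btf x y z Bx By Bz.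
by rewrite xy /= andbC.
Qed.

(** Given B, follow the branch that decides each vertex as B does: it ends in a
    good set that contains B. *)
Lemma exhaustP good cur cand (B : pred T) :
    exhaust good cur cand -> triangle_free B -> all B cur ->
    {subset B <= cur ++ cand} ->
  exists2 U, good U & {subset B <= U}.
Proof.
move=> + Btf; elim: cand cur => [|x cand IH] cur /=;
  set U := cur ++ _; case: ifP => // gU.
- by move=> _ _ Bsub; exists U.
- move=> _ curB Bsub; exists U => // y By.
  have := Bsub y By; rewrite /U -[if _ then _ else _]/(filter _ (x :: cand)).
  by rewrite !mem_cat mem_filter (triangle_free_compatible Btf curB).
case: ifP => // cov_out; case: ifP => [_ cov_in|incompat _] curB Bsub.
  have [Bx|nBx] := boolP (B x).
    apply: IH cov_in _ _ => [|y /Bsub]; first by rewrite /= Bx.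
    by rewrite !(inE, mem_cat) orbCA orbA.
  apply: (IH _ cov_out curB) => y By; have := Bsub y By.
  rewrite !(inE, mem_cat); have [yx|//] := eqVneq y x.
  by rewrite -yx [B y]By in nBx.
apply: (IH _ cov_out curB) => y By; have := Bsub y By.
rewrite !(inE, mem_cat); have [yx|//] := eqVneq y x.
by rewrite -yx (triangle_free_compatible Btf curB) in incompat.
Qed.

(** Backtracking search for a colouring of s with three colours that extends
    the list col of already coloured vertices. *)
Fixpoint colourable3 (col : seq (T * nat)) (s : seq T) : bool :=
  if s is x :: s' then
    let try k := if has (fun p => e x p.1 && (p.2 == k)) col then false
                 else colourable3 ((x, k) :: col) s' in
    if try 0 then true else if try 1 then true else try 2
  else true.

Lemma colourable3P (col : seq (T * nat)) (s : seq T) :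
    symmetric e -> irreflexive e -> colourable3 col s ->
  exists c : T -> 'I_3,
    {in s &, forall x y, e x y -> c x != c y} /\
    {in s, forall x p, p \in col -> e x p.1 -> c x != p.2 :> nat}.
Proof.
move=> e_sym e_irr; elim: s col => [|x s IH] col /=.
  by exists (fun=> ord0).
have extend (k : 'I_3) :
    (if has (fun p => e x p.1 && (p.2 == val k)) col then false
     else colourable3 ((x, val k) :: col) s) ->
  exists c : T -> 'I_3,
    {in x :: s &, forall x y, e x y -> c x != c y} /\
    {in x :: s, forall x p, p \in col -> e x p.1 -> c x != p.2 :> nat}.
  case: ifP => // /hasPn free /IH[c [c_proper c_col]].
  have c_x y : y \in s -> e y x -> c y != k.
    by move=> ys; apply: (c_col y ys (x, val k)); rewrite inE eqxx.
  (* When x occurs again in s, its colour under c is overridden. *)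
  exists (fun y => if y == x then k else c y); split=> [y z|y].
    rewrite !inE; case: (eqVneq y x) => [->|_] /=;
      case: (eqVneq z x) => [->|_] //= ys zs; rewrite ?e_irr //.
    - by rewrite e_sym eq_sym; apply: c_x.
    - exact: c_x.
    exact: c_proper.
  rewrite inE; case: (eqVneq y x) => [-> _ p /free|_ /= ys p pcol].
    by rewrite eq_sym => + xp; rewrite xp.
  by apply: (c_col y ys p); rewrite inE pcol orbT.
case: ifP => [/(extend ord0) // | _].
case: ifP => [/(extend (@Ordinal 3 1 isT)) // | _].
exact: (extend (@Ordinal 3 2 isT)).
Qed.

End Search.

(** * The Paley graph on residues *)

(** Graphs on natural numbers in which adjacency depends on the distance
    |i - j|; the sum of the two truncated differences is that distance. *)
Definition dist_adj (ds : seq nat) : rel nat :=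
  fun i j => (i - j) + (j - i) \in ds.

Lemma dist_adj_sym (ds : seq nat) : symmetric (dist_adj ds).
Proof. by move=> i j; rewrite /dist_adj addnC. Qed.

Lemma dist_adj_irr (ds : seq nat) : 0 \notin ds -> irreflexive (dist_adj ds).
Proof. by move=> /negbTE ds0 i; rewrite /dist_adj subnn. Qed.

Definition squares17 : seq nat := [:: 1; 2; 4; 8; 9; 13; 15; 16].

(** Distances suffice, without reduction modulo 17, because the squares are
    closed under negation: d is listed if and only if 17 - d is. *)
Definition e17 : rel nat := dist_adj squares17.

Lemma e17_sym : symmetric e17.
Proof. exact: dist_adj_sym. Qed.

Lemma e17_irr : irreflexive e17.
Proof. exact: dist_adj_irr. Qed.

Definition pt (n : nat) : paley17 := inZp n.

Lemma pt_val (x : paley17) : pt (val x) = x.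
Proof. exact: valZpK. Qed.

Lemma val_pt n : n < 17 -> val (pt n) = n.
Proof. exact: modn_small. Qed.

Lemma val_paley17 (x : paley17) : val x \in iota 0 17.
Proof. by rewrite mem_iota; exact: (ltn_ord x). Qed.

Lemma nonzero_squareE (a : 'F_17) : nonzero_square a = (val a \in squares17).
Proof.
apply/andP/idP => [[a0 /existsP[z /eqP az]]|].
  suff /allP/(_ _ (val_paley17 z)) :
      all (fun i => (i == 0) || ((i * i) %% 17 \in squares17)) (iota 0 17).
    case/orP => [/eqP z0|]; last by rewrite az.
    by move: a0; rewrite az (_ : z = 0%R) ?GRing.expr0n //; apply: val_inj.
  by vm_compute.
move=> a_sq; split; first by apply: contraTneq a_sq => ->.
have: has (fun i => val a == (i * i) %% 17) (iota 0 17).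
  by move: (val a) a_sq; apply/allP.
case/hasP => i _ /eqP ai; apply/existsP; exists (pt i); apply/eqP/val_inj.
by rewrite ai -modnMm.
Qed.

Lemma paley17_adjE (x y : paley17) : adj x y = e17 (val x) (val y).
Proof.
rewrite /adj /= /paley17_adj nonzero_squareE.
have -> : val (x - y)%R = (val x + (17 - val y) %% 17) %% 17 by [].
rewrite -val_eqE; apply/eqP.
suff /allP adjE : all (fun i => all (fun j =>
    (i != j) && ((i + (17 - j) %% 17) %% 17 \in squares17) == e17 i j)
  (iota 0 17)) (iota 0 17).
  by have /allP/(_ _ (val_paley17 y)) := adjE _ (val_paley17 x); apply.
by vm_compute.
Qed.

Definition labels (B : {set paley17}) : pred nat :=
  fun n => (n < 17) && (pt n \in B).

Lemma labels_val (B : {set paley17}) (x : paley17) : x \in B -> labels B (val x).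
Proof. by move=> xB; rewrite /labels pt_val xB andbT; exact: (ltn_ord x). Qed.

Lemma triangle_free_labels (B : {set paley17}) :
  omega (induced B) <= 2 -> triangle_free e17 (labels B).
Proof.
move=> om2 i j k /andP[i17 iB] /andP[j17 jB] /andP[k17 kB].
apply/negP => /and3P[ij jk ik]; move: om2; rewrite leqNgt => /negP; apply.
pose v n (nB : pt n \in B) : induced B := exist _ (pt n) nB.
apply: (@omega_triangle (induced B) (v i iB) (v j jB) (v k kB));
  by rewrite [adj _ _]paley17_adjE !val_pt.
Qed.

Lemma labels_iota (B : {set paley17}) : {subset labels B <= [::] ++ iota 0 17}.
Proof. by move=> n /andP[n17 _]; rewrite mem_iota. Qed.

(** * The 5-cycle *)

Definition cycle5_adj : rel 'I_5 := fun i j => dist_adj [:: 1; 4] i j.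

Lemma cycle5_sym : symmetric cycle5_adj.
Proof. by move=> i j; apply: dist_adj_sym. Qed.

Lemma cycle5_irr : irreflexive cycle5_adj.
Proof. by move=> i; apply: dist_adj_irr. Qed.

Definition cycle5 : sgraph := SGraph cycle5_sym cycle5_irr.

Lemma omega_cycle5 : omega cycle5 <= 2.
Proof.
rewrite leqNgt; apply/negP => /omega_geP[f fP].
have := fP ord0 (@Ordinal 3 1 isT) isT; have := fP (@Ordinal 3 1 isT) ord_max isT.
have := fP ord0 ord_max isT; rewrite /adj /= /cycle5_adj.
case: (f ord0) => -[|[|[|[|[|//]]]]] ? /=;
  case: (f ord_max) => -[|[|[|[|[|//]]]]] ? //=;
  by case: (f _) => -[|[|[|[|[|//]]]]] ?.
Qed.

Lemma chi_cycle5 : 2 < chi cycle5.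
Proof.
rewrite ltnNge; apply/negP => /chi_leP[c cP].
pose o k k5 := c (@Ordinal 5 k k5).
have : [/\ o 0 isT != o 1 isT, o 1 isT != o 2 isT, o 2 isT != o 3 isT,
          o 3 isT != o 4 isT & o 4 isT != o 0 isT].
  by split; apply: cP.
case; move: (o 0 isT) (o 1 isT) (o 2 isT) (o 3 isT) (o 4 isT).
by do 5 (case=> -[|[|//]] ?).
Qed.

(** * Triangle-free sets avoid an induced 5-cycle *)

(** The cyclic sequence 0, 1, 3, 11, 13 has consecutive differences 1, 2, 8, 2
    and 4, which are squares, while the differences of its non-consecutive terms
    are nonsquares: it is an induced 5-cycle. These are its images under the 136
    automorphisms x |-> a * x + b of the Paley graph, a a nonzero square. *)
Definition pentagons : seq (seq nat) :=
  [seq [seq (a * c + b) %% 17 | c <- [:: 0; 1; 3; 11; 13]]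
     | a <- squares17, b <- iota 0 17].

Definition misses_pentagon (U : seq nat) : bool :=
  has (fun C => ~~ has (fun x => x \in U) C) pentagons.

Lemma exhaust_misses_pentagon : exhaust e17 misses_pentagon [::] (iota 0 17).
Proof. by vm_compute. Qed.

Lemma pentagons_induced (C : seq nat) (i j : 'I_5) :
  C \in pentagons -> e17 (nth 0 C i) (nth 0 C j) = cycle5_adj i j.
Proof.
move=> Cin.
have /allP/(_ C Cin)/allP/(_ i) :
    all (fun C => all (fun i => all (fun j =>
      e17 (nth 0 C i) (nth 0 C j) == dist_adj [:: 1; 4] i j)
    (iota 0 5)) (iota 0 5)) pentagons.
  by vm_compute.
rewrite mem_iota => /(_ (ltn_ord i))/allP/(_ j).
by rewrite mem_iota => /(_ (ltn_ord j))/eqP.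
Qed.

Lemma triangle_free_misses_cycle5 (B : {set paley17}) :
  omega (induced B) <= 2 ->
  exists f : cycle5 -> paley17,
    (forall i j, adj (f i) (f j) = adj i j) /\ (forall i, f i \notin B).
Proof.
move=> /triangle_free_labels Btf.
have [U /hasP[C Cin /hasPn CU] BU] :=
  exhaustP exhaust_misses_pentagon Btf isT (@labels_iota B).
have C17 : all (fun n => n < 17) C.
  by move: C Cin {CU}; apply/allP; vm_compute.
have C_in (i : 'I_5) : nth 0 C i \in C.
  apply: mem_nth; suff -> : size C = 5 by [].
  by move: Cin => /allpairsP[[a b] [_ _ ->]].
have C_lt (i : 'I_5) := allP C17 _ (C_in i).
exists (fun i : cycle5 => pt (nth 0 C i)).
split=> [i j|i]; first by rewrite paley17_adjE !val_pt // pentagons_induced.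
apply/negP => /labels_val; rewrite val_pt // => /BU.
by apply/negP/CU.
Qed.

(** * The bound for the Paley graph *)

Lemma chi_paley17 : chi paley17 <= 6.
Proof.
pose c := nth 0 [:: 0; 1; 2; 0; 1; 2; 0; 1; 2; 3; 4; 5; 3; 4; 5; 3; 4].
apply/chi_leP; exists (fun x : paley17 => inord (c (val x)) : complete 6) => x y.
suff : all (fun i => all (fun j =>
    [&& c i < 6, c j < 6 & e17 i j ==> (c i != c j)])
  (iota 0 17)) (iota 0 17).
  move=> /allP/(_ _ (val_paley17 x))/allP/(_ _ (val_paley17 y)) /and3P[cx cy].
  rewrite -paley17_adjE => /implyP cP /cP; apply: contra.
  by move/eqP/(congr1 (@nat_of_ord 6)); rewrite !inordK // => ->.
by vm_compute.
Qed.

Lemma exhaust_colourable3 : exhaust e17 (colourable3 e17 [::]) [::] (iota 0 17).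
Proof. by vm_compute. Qed.

Lemma chi_triangle_free_paley17 (B : {set paley17}) :
  omega (induced B) <= 2 -> chi (induced B) <= 3.
Proof.
move=> /triangle_free_labels Btf; apply/chi_leP.
have [U colU BU] := exhaustP exhaust_colourable3 Btf isT (@labels_iota B).
have [c [c_proper _]] := colourable3P e17_sym e17_irr colU.
exists (fun u : induced B => c (val (val u))) => u v uv.
have in_U (w : induced B) : val (val w) \in U by apply/BU/labels_val/(valP w).
by apply: c_proper; rewrite ?in_U // -paley17_adjE.
Qed.

Lemma chi_paley17_bound (S : {set paley17}) :
  chi (induced S) <= 'C(omega (induced S) + 1, 2).
Proof.
have [om3|om2] := leqP 3 (omega (induced S)).
  apply: leq_trans (leq_chi (hom_induced S)) (leq_trans chi_paley17 _).
  by rewrite -[6]/('C(4, 2)) leq_bin2l // addn1.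
have [om2'|om1] := leqP 2 (omega (induced S)).
  apply: leq_trans (chi_triangle_free_paley17 _) _; first exact: om2.
  by rewrite -[3]/('C(3, 2)) leq_bin2l // addn1.
apply: leq_trans (chi_le_omega1 _) _; first exact: om1.
by case: (omega _) om1 => [|[|]].
Qed.

(** * Failure of perfect divisibility *)

Lemma omega_paley17 : omega paley17 <= 3.
Proof.
rewrite leqNgt; apply/negP => /omega_geP[f fP].
pose o k k4 := f (@Ordinal 4 k k4).
have adj_o k l k4 l4 : k != l -> e17 (val (o k k4)) (val (o l l4)).
  by move=> kl; rewrite -paley17_adjE; apply: fP.
have no_K4 : all (fun x => let N := filter (e17 x) (iota 0 17) in
    all (fun y => let M := filter (e17 y) N in
      all (fun z => ~~ has (e17 z) M) M) N) (iota 0 17).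
  by vm_compute.
move/allP/(_ _ (val_paley17 (o 0 isT))): no_K4.
move/allP/(_ (val (o 1 isT))).
rewrite mem_filter val_paley17 adj_o // => /(_ isT).
move/allP/(_ (val (o 2 isT))).
rewrite !mem_filter val_paley17 !adj_o // => /(_ isT).
move/hasPn/(_ (val (o 3 isT))).
by rewrite !mem_filter val_paley17 !adj_o // => /(_ isT).
Qed.

(** The witness S is the copy of paley17 inside the join; B0 and f live in paley17
    itself, and emb carries them to that copy. *)
Lemma join_complete_not_perfectly_divisible (t : nat) :
  ~ perfectly_divisible (join paley17 (complete t)).
Proof.
pose J := join paley17 (complete t).
pose S : {set J} := inl @: [set: paley17].
have inS x : inl x \in S by apply: imset_f.
pose emb x : induced S := exist _ (inl x) (inS x).
have omS : omega (induced S) <= 3.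
  apply: leq_trans omega_paley17; apply: leq_omega.
  exists (fun u => if val u is inl x then x else pt 0) => u v.
  case/imsetP: (valP u) (valP v) => x _ ux /imsetP[y _ vy].
  by rewrite -[adj u v]/(adj (val u) (val v)) ux vy.
move=> /(_ S)[|A [B [AB _ perfA omB]]].
  exists (emb (pt 0)), (emb (pt 1)).
  by rewrite [adj _ _]paley17_adjE.
pose B0 : {set paley17} := [set x | emb x \in B].
have homB0 : hom (induced B0) (induced B).
  have inB (u : induced B0) : emb (val u) \in B by have := valP u; rewrite inE.
  by exists (fun u => exist _ (emb (val u)) (inB u)).
have /triangle_free_misses_cycle5[f [fE f_out]] : omega (induced B0) <= 2.
  by rewrite -ltnS (leq_ltn_trans (leq_omega homB0)) // (leq_trans omB).
have inA i : emb (f i) \in A.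
  have : emb (f i) \in A :|: B by rewrite AB.
  by have := f_out i; rewrite !inE => /negbTE ->; rewrite orbF.
pose emA i : induced A := exist _ (emb (f i)) (inA i).
have chi_omega : chi cycle5 = omega cycle5.
  exact: (@perfect_embedding _ _ emA fE perfA).
by have := chi_cycle5; rewrite chi_omega ltnNge omega_cycle5.
Qed.

Theorem mainTheorem4 (t : nat) :
  (forall S : {set join paley17 (complete t)},
     chi (induced S) <= 'C(omega (induced S) + 1, 2)) /\
  ~ perfectly_divisible (join paley17 (complete t)).
Proof.
split; last exact: join_complete_not_perfectly_divisible.
exact: join_complete_bound chi_paley17_bound.
Qed.
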